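(* Let $(\mathcal{M},\mathfrak{g})$ be a Riemannian manifold, let $\rho\ge0$, $\theta\ge0$, and let $f:\mathcal{M}\to\mathbb{R}$ be a twice differentiable function with $\rho$-Lipschitz continuous Riemannian Hessians. Let $M>\rho/2$. Consider the Riemannian cubic-regularized Newton algorithm: starting from $x_0\in\mathcal{M}$, for $k\ge0$, $$x_{k+1}=\mathrm{Exp}_{x_k}(s_k),$$ where $s_k\in\mathcal{T}_{x_k}\mathcal{M}$ (in the domain of $\mathrm{Exp}_{x_k}$) satisfies $$m_k(s_k)\le m_k(0),\qquad\|\nabla m_k(s_k)\|_{x_k}\le\theta\|s_k\|_{x_k}^2,$$ with $$m_k(s):=f(x_k)+\langle s,\mathrm{grad} f(x_k)\rangle_{x_k}+\tfrac12\langle s,\mathrm{Hess} f(x_k)[s]\rangle_{x_k}+\tfrac{M}{3}\|s\|_{x_k}^3,\qquad s\in\mathcal{T}_{x_k}\mathcal{M}.$$ Then this algorithm is a $3$-forward descent algorithm with respect to $f$: there is a constant $c>0$, independent of $k$, such that $$f(x_{k+1})\le f(x_k)-c\,\|\mathrm{grad} f(x_{k+1})\|_{x_{k+1}}^{3/2}\qquad\text{for all }k\ge0.$$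
   Context: For $x\in\mathcal{M}$, $\langle\cdot,\cdot\rangle_x$ and $\|\cdot\|_x$ are the Riemannian inner product and norm on $\mathcal{T}_x\mathcal{M}$; $\mathrm{grad} f(x)$ and $\mathrm{Hess} f(x)$ are the Riemannian gradient and Hessian; $\mathrm{Exp}_x$ is the exponential map; $\nabla m_k$ is the gradient of $m_k$ on the inner product space $\mathcal{T}_{x_k}\mathcal{M}$. A twice differentiable $f$ is said to have $\rho$-Lipschitz continuous Riemannian Hessians when for all $x\in\mathcal{M}$ and $s$ in the domain of $\mathrm{Exp}_x$, $$\left|f(\mathrm{Exp}_x(s))-f(x)-\langle s,\mathrm{grad} f(x)\rangle_x-\tfrac12\langle s,\mathrm{Hess} f(x)[s]\rangle_x\right|\le\tfrac{\rho}{6}\|s\|_x^3,$$ and (treated as an equivalent form of this property) $$\left\|\Gamma_s^{-1}\,\mathrm{grad} f(\mathrm{Exp}_x(s))-\mathrm{grad} f(x)-\mathrm{Hess} f(x)[s]\right\|_x\le\tfrac{\rho}{2}\|s\|_x^2,$$ where $\Gamma_s:\mathcal{T}_x\mathcal{M}\to\mathcal{T}_{\mathrm{Exp}_x(s)}\mathcal{M}$ is parallel transport (a linear isometry) along the geodesic $t\mapsto\mathrm{Exp}_x(ts)$, $t\in[0,1]$. *)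

(* Defs.v *)
From HB Require Import structures.
From mathcomp Require Import all_boot all_order all_algebra.
From mathcomp Require Import all_classical all_reals all_analysis.
From mathcomp Require Import ring.

Set Implicit Arguments.
Unset Strict Implicit.
Unset Printing Implicit Defensive.

Import Order.TTheory GRing.Theory Num.Theory.
Import numFieldNormedType.Exports.

Local Open Scope classical_set_scope.
Local Open Scope ring_scope.

Section EuclideanCalculus.
Context {R : realType} {n : nat}.

Fixpoint Ck_on {W : normedModType R} (k : nat) (U : set 'rV[R]_n)
    (h : 'rV[R]_n -> W) : Prop :=
  match k with
  | 0 => forall u, U u -> {for u, continuous h}
  | k'.+1 => (forall u, U u -> differentiable h u) /\
             (forall v, Ck_on k' U (fun u => 'D_v h u))
  end.

Definition smooth_on {W : normedModType R} (U : set 'rV[R]_n)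
    (h : 'rV[R]_n -> W) : Prop :=
  forall k, Ck_on k U h.

Definition partial (a : 'I_n) (h : 'rV[R]_n -> R) (u : 'rV[R]_n) : R :=
  'D_(delta_mx 0 a) h u.

Definition bilin (G : 'M[R]_n) (v w : 'rV[R]_n) : R := (v *m G *m w^T) 0 0.

(* The gradient at u of h for the inner product with Gram matrix G, that is,
   (G^-1)^{ab} (d_b h); see gradientP for its defining property. *)
Definition gradient (G : 'M[R]_n) (h : 'rV[R]_n -> R) (u : 'rV[R]_n)
    : 'rV[R]_n :=
  (\row_a partial a h u) *m invmx G.

Lemma bilin_pos_unitmx (G : 'M[R]_n) :
  (forall v, v != 0 -> 0 < bilin G v v) -> G \in unitmx.
Proof.
move=> Gpos; rewrite -row_free_unit -kermx_eq0.
apply/negPn/negP => /rowV0Pn[v /sub_kermxP vG v0].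
by have := Gpos v v0; rewrite /bilin vG mul0mx mxE ltxx.
Qed.

Lemma gradientP (G : 'M[R]_n) (h : 'rV[R]_n -> R) (u v : 'rV[R]_n) :
  G \in unitmx -> differentiable h u ->
  bilin G (gradient G h u) v = 'd h u v.
Proof.
move=> Gu dh; rewrite /bilin /gradient mulmxKV //.
rewrite [in RHS](row_sum_delta v) linear_sum mxE; apply: eq_bigr => a _.
by rewrite !mxE /partial deriveE // linearZ mulrC.
Qed.

End EuclideanCalculus.

(* The atlas is a family of charts indexed by chart_index.  Chart i is the
   homeomorphism chart i from the open set chart_dom i onto an open subset of
   R^n, with inverse chart_inv i; the values of the total functions chart i
   and chart_inv i elsewhere are irrelevant. *)
Record smoothManifold (R : realType) (n : nat) := SmoothManifold {
  points :> topologicalType ;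
  points_hausdorff : hausdorff_space points ;
  points_second_countable : @second_countable points ;
  chart_index : Type ;
  chart_dom : chart_index -> set points ;
  chart : chart_index -> points -> 'rV[R]_n ;
  chart_inv : chart_index -> 'rV[R]_n -> points ;
  chart_dom_open : forall i, open (chart_dom i) ;
  chart_cod_open : forall i, open (chart i @` chart_dom i) ;
  chartK : forall i x, chart_dom i x -> chart_inv i (chart i x) = x ;
  chart_continuous : forall i x, chart_dom i x ->
    {for x, continuous (chart i)} ;
  chart_inv_continuous : forall i x, chart_dom i x ->
    {for chart i x, continuous (chart_inv i)} ;
  transition_smooth : forall i j,
    smooth_on (chart i @` (chart_dom i `&` chart_dom j))
      (chart j \o chart_inv i) ;
  chart_at : points -> chart_index ;
  chart_at_dom : forall x, chart_dom (chart_at x) x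
}.

(* A tangent vector at x is represented by its coordinates in the distinguished
   chart chart_at x, so every tangent space is 'rV[R]_n as a vector space;
   tangent_coord i x v gives its coordinates in another chart i around x. *)
Definition tangent_coord (R : realType) (n : nat) (X : smoothManifold R n)
    (i : chart_index X) (x : X) (v : 'rV[R]_n) : 'rV[R]_n :=
  'D_v (chart i \o chart_inv (chart_at x)) (chart (chart_at x) x).

(* metric i u is the Gram matrix of the coordinate frame of chart i at the
   point of coordinates u; metric_transition is the tensor law making these
   matrices the expressions of a single covariant 2-tensor field. *)
Record riemannianManifold (R : realType) (n : nat) := RiemannianManifold {
  base :> smoothManifold R n ;
  metric : chart_index base -> 'rV[R]_n -> 'M[R]_n ;
  metric_smooth : forall i, smooth_on (chart i @` chart_dom i) (metric i) ;
  metric_sym : forall i x, chart_dom i x ->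
    (metric i (chart i x))^T = metric i (chart i x) ;
  metric_pos : forall i x, chart_dom i x -> forall v, v != 0 ->
    0 < bilin (metric i (chart i x)) v v ;
  metric_transition : forall i j x, chart_dom i x -> chart_dom j x ->
    forall v w,
    bilin (metric j (chart j x))
      ('D_v (chart j \o chart_inv i) (chart i x))
      ('D_w (chart j \o chart_inv i) (chart i x)) =
    bilin (metric i (chart i x)) v w
}.

Section RiemannianGeometry.
Context {R : realType} {n : nat} (X : riemannianManifold R n).
Implicit Types (x : X) (i : chart_index X) (s u v w : 'rV[R]_n).
Implicit Types (f : X -> R) (c : R -> X).

Definition gram x : 'M[R]_n := metric (chart_at x) (chart (chart_at x) x).

Definition inner x v w : R := bilin (gram x) v w.

Definition rnorm x v : R := Num.sqrt (inner x v v).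

(* Gamma^k_{ab} of the Levi-Civita connection in chart i. *)
Definition christoffel_symbol i u (a b k : 'I_n) : R :=
  2^-1 * \sum_l invmx (metric i u) k l *
    (partial a (fun y => metric i y b l) u +
     partial b (fun y => metric i y a l) u -
     partial l (fun y => metric i y a b) u).

Definition christoffel i u v w : 'rV[R]_n :=
  \row_k \sum_a \sum_b christoffel_symbol i u a b k * v 0 a * w 0 b.

Definition twice_differentiable f : Prop :=
  forall i x, chart_dom i x ->
    differentiable (f \o chart_inv i) (chart i x) /\
    forall v, differentiable (fun u => 'D_v (f \o chart_inv i) u) (chart i x).

Definition chart_grad f i u : 'rV[R]_n :=
  gradient (metric i u) (f \o chart_inv i) u.

Definition grad f x : 'rV[R]_n :=
  chart_grad f (chart_at x) (chart (chart_at x) x).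

(* The covariant derivative of the gradient field in the direction s. *)
Definition hess f x s : 'rV[R]_n :=
  let i := chart_at x in
  let u := chart i x in
  'D_s (chart_grad f i) u + christoffel i u s (chart_grad f i u).

Definition geodesic_at c (t : R) : Prop :=
  {for t, continuous c} /\
  forall i, chart_dom i (c t) ->
    let y := chart i \o c in
    [/\ \forall r \near t, derivable y r 1,
        derivable (fun r => 'D_1 y r) t 1 &
        'D_1 (fun r => 'D_1 y r) t =
          - christoffel i (y t) ('D_1 y t) ('D_1 y t)].

(* c is a geodesic, on an open interval containing [0, 1], issued from x with
   initial velocity s. *)
Definition geodesic_from x s c : Prop :=
  [/\ c 0 = x,
      'D_1 (chart (chart_at x) \o c) 0 = s &
      exists2 e : R, 0 < e & forall t, - e < t < 1 + e -> geodesic_at c t].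

Definition exp_dom x : set 'rV[R]_n :=
  [set s | exists c, geodesic_from x s c].

(* For s in exp_dom x, the geodesic t |-> Exp_x (t s), t in [0, 1]. *)
Definition exp_curve x s : R -> X := xget (fun=> x) (geodesic_from x s).

Definition rexp x s : X := exp_curve x s 1.

(* V t stands for a tangent vector at c t. *)
Definition parallel_at c (V : R -> 'rV[R]_n) (t : R) : Prop :=
  forall i, chart_dom i (c t) ->
    let W := fun r => tangent_coord i (c r) (V r) in
    derivable W t 1 /\
    'D_1 W t = - christoffel i (chart i (c t)) ('D_1 (chart i \o c) t) (W t).

(* Parallel transport along c takes v at c 0 to w at c 1. *)
Definition parallel_transport c v w : Prop :=
  exists V : R -> 'rV[R]_n,
    [/\ V 0 = v, V 1 = w &
        exists2 e : R, 0 < e & forall t, - e < t < 1 + e -> parallel_at c V t].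

(* In the second clause g is Gamma_s^{-1} (grad f (Exp_x s)): parallel transport
   being a bijection, it is the unique vector that Gamma_s takes to
   grad f (Exp_x s). *)
Definition lipschitz_hessian (rho : R) f : Prop :=
  (forall x s, exp_dom x s ->
     `|f (rexp x s) - f x - inner x s (grad f x)
        - 2^-1 * inner x s (hess f x s)| <= rho / 6 * rnorm x s ^+ 3) /\
  (forall x s, exp_dom x s ->
     exists2 g, parallel_transport (exp_curve x s) g (grad f (rexp x s)) &
       rnorm x (g - grad f x - hess f x s) <= rho / 2 * rnorm x s ^+ 2).

Definition cubic_model f (M : R) x s : R :=
  f x + inner x s (grad f x) + 2^-1 * inner x s (hess f x s)
    + M / 3 * rnorm x s ^+ 3.

Definition model_grad f (M : R) x s : 'rV[R]_n :=
  gradient (gram x) (cubic_model f M x) s.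

Definition cubic_newton_run f (M theta : R) (x : nat -> X)
    (s : nat -> 'rV[R]_n) : Prop :=
  forall k,
    [/\ exp_dom (x k) (s k),
        x k.+1 = rexp (x k) (s k),
        cubic_model f M (x k) (s k) <= cubic_model f M (x k) 0 &
        rnorm (x k) (model_grad f M (x k) (s k))
          <= theta * rnorm (x k) (s k) ^+ 2].

Lemma partial_metricC i x a b l : chart_dom i x ->
  partial l (fun y => metric i y a b) (chart i x) =
  partial l (fun y => metric i y b a) (chart i x).
Proof.
move=> ix; apply: near_eq_derive.
have : nbhs (chart i x) (chart i @` chart_dom i).
  by apply: open_nbhs_nbhs; split; [exact: chart_cod_open | exists x].
apply: filterS => _ [y iy <-].
by rewrite -[in LHS](metric_sym iy) mxE.
Qed.

(* The connection defined by the Christoffel symbols is torsion-free and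
   compatible with the metric. *)
Lemma christoffel_symbolC i x a b k : chart_dom i x ->
  christoffel_symbol i (chart i x) a b k =
  christoffel_symbol i (chart i x) b a k.
Proof.
move=> ix; rewrite /christoffel_symbol; congr (_ * _).
apply: eq_bigr => l _; congr (_ * _).
by rewrite (partial_metricC a b) // [X in X - _]addrC.
Qed.

Lemma christoffel_symbol_compat i x a b l : chart_dom i x ->
  let G := metric i (chart i x) in
  partial l (fun y => metric i y a b) (chart i x) =
  \sum_k (christoffel_symbol i (chart i x) l a k * G k b +
          christoffel_symbol i (chart i x) l b k * G a k).
Proof.
move=> ix G; set u := chart i x.
have Gu : G \in unitmx.
  by apply: bilin_pos_unitmx => v v0; exact: metric_pos.
have GT (p q : 'I_n) : G p q = G q p.
  by rewrite /G -[in LHS](metric_sym ix) mxE.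
have lower (c d e : 'I_n) : \sum_k christoffel_symbol i u c d k * G e k =
    2^-1 * (partial c (fun y => metric i y d e) u +
            partial d (fun y => metric i y c e) u -
            partial e (fun y => metric i y c d) u).
  pose A (q : 'I_n) := partial c (fun y => metric i y d q) u +
    partial d (fun y => metric i y c q) u - partial q (fun y => metric i y c d) u.
  rewrite -[X in _ = _ * X]/(A e).
  transitivity (2^-1 * \sum_q (G *m invmx G) e q * A q).
    rewrite mulr_sumr.
    under [RHS]eq_bigr do rewrite mxE mulr_suml mulr_sumr.
    rewrite exchange_big /=; apply: eq_bigr => k _.
    rewrite /christoffel_symbol mulr_sumr mulr_suml; apply: eq_bigr => q _.
    rewrite -[X in _ * (_ * X)]/(A q) -/u -/G; ring.
  congr (_ * _); rewrite mulmxV // (bigD1 e) //= mxE eqxx mul1r big1 ?addr0 //.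
  by move=> q qe; rewrite mxE eq_sym (negbTE qe) mul0r.
rewrite big_split /=.
under eq_bigr do rewrite GT.
rewrite !lower (partial_metricC b a) // (partial_metricC l b) //.
rewrite (partial_metricC l a) //.
by field.
Qed.

End RiemannianGeometry.

(* Main.v *)
Require Import Defs.
From HB Require Import structures.
From mathcomp Require Import all_boot all_order all_algebra.
From mathcomp Require Import all_classical all_reals all_analysis.
From mathcomp Require Import ring lra.
Import Order.TTheory GRing.Theory Num.Theory.
Import numFieldNormedType.Exports.
Local Open Scope classical_set_scope.
Local Open Scope ring_scope.

(* Writing r = |s_k|, the Lipschitz bound on f and m_k(s_k) <= m_k(0) give
   f(x_{k+1}) <= f(x_k) - (M/3 - rho/6) r^3. Since the Hessian is self-adjoint
   (Schwarz's theorem, torsion-freeness and metric compatibility), the gradient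
   of m_k at s_k is grad f + Hess f [s_k] + M r s_k; since parallel transport is
   isometric, the Lipschitz bound on the gradient and the triangle inequality
   give |grad f(x_{k+1})| <= C r^2 with C = rho/2 + theta + M. Hence
   c = (M/3 - rho/6) / C^(3/2). *)

Set Implicit Arguments.
Unset Strict Implicit.
Unset Printing Implicit Defensive.

(** * The inner product of a Gram matrix: bilinearity, Cauchy-Schwarz, triangle inequality *)

Section Bilin.
Context {R : realType} {n : nat}.
Implicit Types (G : 'M[R]_n) (u v w : 'rV[R]_n) (a : R).

Lemma bilinE G v w :
  bilin G v w = \sum_i \sum_j v 0 i * G i j * w 0 j.
Proof.
rewrite /bilin mxE exchange_big /=; apply: eq_bigr => j _.
by rewrite mxE mulr_suml; apply: eq_bigr => i _; rewrite mxE.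
Qed.

Lemma bilinDl G u v w : bilin G (u + v) w = bilin G u w + bilin G v w.
Proof. by rewrite /bilin !mulmxDl mxE. Qed.

Lemma bilinZl G a v w : bilin G (a *: v) w = a * bilin G v w.
Proof. by rewrite /bilin -!scalemxAl mxE. Qed.

Lemma bilinDr G u v w : bilin G u (v + w) = bilin G u v + bilin G u w.
Proof. by rewrite /bilin linearD /= mulmxDr mxE. Qed.

Lemma bilinZr G a v w : bilin G v (a *: w) = a * bilin G v w.
Proof. by rewrite /bilin linearZ /= -scalemxAr mxE. Qed.

Lemma bilin0l G w : bilin G 0 w = 0.
Proof. by rewrite /bilin !mul0mx mxE. Qed.

Lemma bilinC G v w : G^T = G -> bilin G v w = bilin G w v.
Proof.
move=> Gsym; rewrite !bilinE exchange_big /=.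
apply: eq_bigr => i _; apply: eq_bigr => j _.
by rewrite -[in LHS]Gsym mxE; ring.
Qed.

Lemma eq_bilinr G v v' : G \in unitmx ->
  (forall w, bilin G v w = bilin G v' w) -> v = v'.
Proof.
move=> Gu eq_vv'; apply: (can_inj (mulmxK Gu)); apply/rowP => j.
have := eq_vv' (delta_mx 0 j); rewrite /bilin trmx_delta -!colE.
by rewrite !mxE.
Qed.

Lemma bilin_cauchy_schwarz G v w : G^T = G ->
  (forall u, u != 0 -> 0 < bilin G u u) ->
  bilin G v w <= Num.sqrt (bilin G v v) * Num.sqrt (bilin G w w).
Proof.
move=> Gsym Gpos.
have G_ge0 u : 0 <= bilin G u u.
  by have [->|/Gpos/ltW//] := eqVneq u 0; rewrite bilin0l.
have [->|v0] := eqVneq v 0; first by rewrite !bilin0l sqrtr0 mul0r.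
have [->|w0] := eqVneq w 0.
  by rewrite bilinC// !bilin0l sqrtr0 mulr0.
set p := Num.sqrt (bilin G v v); set q := Num.sqrt (bilin G w w).
have p_gt0 : 0 < p by rewrite sqrtr_gt0 Gpos.
have q_gt0 : 0 < q by rewrite sqrtr_gt0 Gpos.
(* With [p], [q] the norms of [v], [w], the squared norm of [q v - p w] is
   [2 p q (p q - bilin G v w)], and [p q > 0] can be cancelled. *)
have := G_ge0 (q *: v + (- p) *: w).
rewrite bilinDl !bilinDr !bilinZl !bilinZr (bilinC w v Gsym).
rewrite -[bilin G v v]sqr_sqrtr// -[bilin G w w]sqr_sqrtr// -/p -/q => h.
have pq_gt0 : 0 < p * q by rewrite mulr_gt0.
rewrite -(ler_pM2l pq_gt0); lra.
Qed.

Lemma bilin_norm_triangle G v w : G^T = G ->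
  (forall u, u != 0 -> 0 < bilin G u u) ->
  Num.sqrt (bilin G (v + w) (v + w)) <=
    Num.sqrt (bilin G v v) + Num.sqrt (bilin G w w).
Proof.
move=> Gsym Gpos.
have G_ge0 u : 0 <= bilin G u u.
  by have [->|/Gpos/ltW//] := eqVneq u 0; rewrite bilin0l.
have cs := bilin_cauchy_schwarz v w Gsym Gpos.
rewrite -[leRHS]ger0_norm ?addr_ge0 ?sqrtr_ge0// -sqrtr_sqr ler_wsqrtr//.
rewrite sqrrD !sqr_sqrtr// bilinDl !bilinDr (bilinC w v Gsym); lra.
Qed.

End Bilin.

(** * Directional derivatives of determinants, inverse matrices and bilinear forms *)

Section DirectionalDerivative.
Context {R : realType} {V : normedModType R}.
Implicit Types (t d : V).

Lemma is_derive_fsum {W : normedModType R} {I : finType} (F : I -> V -> W)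
    (dF : I -> W) t d :
  (forall i, is_derive t d (F i) (dF i)) ->
  is_derive t d (fun y => \sum_i F i y) (\sum_i dF i).
Proof.
move=> h; rewrite -fct_sumE.
elim/big_ind2 : _ => [|*|i _]; [exact: is_derive_cst|exact: is_deriveD|].
exact: h.
Qed.

Lemma derivable_fprod {I : finType} (F : I -> V -> R) t d :
  (forall i, derivable (F i) t d) ->
  derivable (fun y => \prod_i F i y) t d.
Proof.
move=> h; rewrite -fct_prodE.
apply: (big_ind (fun g : V -> R => derivable g t d)) => [|f g|i _].
- exact: derivable_cst.
- exact: derivableM.
- exact: h.
Qed.

Lemma derivable_det {n} (A : V -> 'M[R]_n) t d :
  derivable A t d -> derivable (fun y => \det (A y)) t d.
Proof.
move/derivable_mxP => dA; rewrite /determinant.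
apply: ex_derive; apply: is_derive_fsum => s; apply/derivableP.
apply: derivableM; first exact: derivable_cst.
exact: derivable_fprod.
Qed.

(** Cramer's rule: the inverse is the adjugate over the determinant, both polynomial in the entries.
    As [invmx] returns a singular matrix unchanged, the formula is used only near [t], where [A y]
    is invertible. *)
Lemma derivable_invmx {n} (A : V -> 'M[R]_n) t d :
  derivable A t d -> (\forall y \near t, A y \in unitmx) ->
  derivable (fun y => invmx (A y)) t d.
Proof.
move=> dA Au; pose B y := (\det (A y))^-1 *: \adj (A y).
have AB : {near t, B =1 (fun y => invmx (A y))}.
  by apply: filterS Au => y Ay; rewrite /B /invmx Ay.
apply: (near_eq_derivable AB); apply/derivable_mxP => i j.
rewrite (_ : (fun y => B y i j) =
  (fun y => (\det (A y))^-1) * (fun y => cofactor (A y) j i)); last first.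
  by apply/funext => y; rewrite /B !mxE.
apply: derivableM.
  apply: derivableV; last exact: derivable_det.
  by rewrite -unitfE -unitmxE; exact: nbhs_singleton Au.
apply: derivableM; first exact: derivable_cst.
apply: derivable_det; apply/derivable_mxP => k l.
under eq_fun do rewrite !mxE.
by move/derivable_mxP : dA; exact.
Qed.

Lemma is_derive_bilin {n} (A : V -> 'M[R]_n) (v w : V -> 'rV[R]_n) t d :
  derivable A t d -> derivable v t d -> derivable w t d ->
  is_derive t d (fun y => bilin (A y) (v y) (w y))
    (bilin ('D_d A t) (v t) (w t) + bilin (A t) ('D_d v t) (w t)
     + bilin (A t) (v t) ('D_d w t)).
Proof.
move=> dA dv dw; rewrite (derive_mx dA) (derive_mx dv) (derive_mx dw).
move: dA dv dw => /derivable_mxP dA /derivable_mxP dv /derivable_mxP dw.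
under eq_fun do rewrite bilinE.
apply: is_derive_eq.
  apply: is_derive_fsum => i; apply: is_derive_fsum => j.
  exact: (is_deriveM (is_deriveM (derivableP (dv 0 i)) (derivableP (dA i j)))
    (derivableP (dw 0 j))).
rewrite !bilinE -!big_split /=; apply: eq_bigr => i _.
rewrite -!big_split /=; apply: eq_bigr => j _.
rewrite !mxE /GRing.scale /= fctE; ring.
Qed.

End DirectionalDerivative.

(** * Derivatives along curves and lines *)

Section Curves.
Context {R : realType}.

Lemma is_derive_comp_curve {V W : normedModType R} (g : V -> W) (c : R -> V)
    (t : R) :
  differentiable g (c t) -> derivable c t 1 ->
  is_derive t 1 (g \o c) ('D_('D_1 c t) g (c t)).
Proof.
move=> dg dc; have dc' := (derivable1_diffP _ _).1 dc.
apply: DeriveDef; first exact/derivable1_diffP/differentiable_comp.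
rewrite deriveE; last exact: differentiable_comp.
by rewrite diff_comp//= (deriveE _ dg) (deriveE _ dc').
Qed.

Lemma is_derive_line {V : normedModType R} (a v : V) (t : R) :
  is_derive t 1 (fun r : R => a + r *: v) v.
Proof.
apply: DeriveDef.
  by apply/derivable1_diffP; apply: differentiableD.
rewrite deriveE; last by apply: differentiableD.
by rewrite diff_val /= add0r scale1r.
Qed.

(** Makes one-variable tools, such as the chain rule for the square root and Carathéodory's
    criterion, available for directional derivatives. *)
Lemma is_derive_along {V W : normedModType R} (g : V -> W) (x v : V)
    (d : W) :
  is_derive (0 : R) 1 (fun h : R => g (h *: v + x)) d <-> is_derive x v g d.
Proof.
have E : 'D_1 (fun h : R => g (h *: v + x)) 0 = 'D_v g x.
  rewrite /derive; set g1 := fun h => h^-1 *: _; set g2 := fun h => h^-1 *: _.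
  suff -> : g1 = g2 by [].
  by rewrite funeqE /g1 /g2 => h /=; rewrite addr0 scale0r add0r [_%:A]mulr1.
split=> -[dg <-]; apply: DeriveDef => //.
  exact: (derivable1P g x v).2.
exact: (derivable1P g x v).1.
Qed.

Lemma is_derive_linear {V W : normedModType R} (l : V -> W) (x v : V) :
  (forall (a : R) y z, l (a *: y + z) = a *: l y + l z) ->
  is_derive x v l (l v).
Proof.
move=> ladd; apply/is_derive_along.
rewrite (_ : (fun h => _) = (fun h : R => l x + h *: l v)).
  exact: is_derive_line.
by apply/funext => h; rewrite ladd addrC.
Qed.

End Curves.

(** * Symmetry of second derivatives *)

Section SchwarzSymmetry.
Context {R : realType} {V : normedModType R}.
Implicit Types (h : V -> R) (u v w : V).

(* By the mean value theorem applied to r |-> h (u + t w + r v) - h (u + r v),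
   the second difference is t times an increment of D_v h, whose expansion at u
   gives the limit. The second difference being symmetric in v and w, this
   yields derive_swap without continuity of the second derivatives. *)
Lemma cvg_second_difference h u v w :
  (\forall y \near u, differentiable h y) ->
  differentiable (fun y => 'D_v h y) u ->
  t ^- 2 * (h (u + t *: v + t *: w) - h (u + t *: v) - h (u + t *: w) + h u)
    @[t --> 0^'+] --> 'D_w (fun y => 'D_v h y) u.
Proof.
move=> dh dg; set g := fun y => 'D_v h y; set L := 'd g u.
rewrite deriveE// -/L.
apply/cvgrPdist_le => e e0.
(* [t * K] bounds the sum of the norms of the displacements [xi *: v] and [xi *: v + t *: w] at
   which [g] is expanded below; the added 1 keeps [K] positive. *)
pose K := 2 * `|v| + `|w| + 1.
have K0 : 0 < K by rewrite ltr_wpDl// addr_ge0// mulr_ge0.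
have e'0 : 0 < e / K by rewrite divr_gt0.
have /eqaddoP /(_ _ e'0) := diff_locally dg.
move: dh; rewrite (near_shift 0) subr0 => dh near_g.
have [del /= del0 near0] := (nbhs_ballP _ _).1 (filterI dh near_g).
have small z : `|z| < del -> differentiable h (z + u) /\
    `|g (z + u) - g u - L z| <= e / K * `|z|.
  move=> zdel; have [hz gz] : differentiable h (z + u) /\
      `|g (z + u) - (g u + L z)| <= e / K * `|z|.
    by apply: near0; rewrite -ball_normE /= sub0r normrN.
  by split=> //; rewrite -addrA -opprD.
near=> t.
have t0 : 0 < t by near: t; exact: nbhs_right_gt.
have tK : t * K < del.
  rewrite -ltr_pdivlMr//; near: t; apply: nbhs_right_lt.
  by rewrite divr_gt0.
have bnd r : 0 <= r <= t -> `|r *: v| <= t * `|v| /\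
    `|r *: v + t *: w| <= t * (`|v| + `|w|).
  move=> /andP[r0 rt].
  have rv : `|r *: v| <= t * `|v| by rewrite normrZ ger0_norm// ler_wpM2r.
  split=> //; rewrite (le_trans (ler_normD _ _))// mulrDr lerD//.
  by rewrite normrZ ger0_norm// ltW.
have lt1 r : 0 <= r <= t -> `|r *: v| < del /\ `|r *: v + t *: w| < del.
  move=> /bnd[b1 b2]; split.
    apply: le_lt_trans b1 (le_lt_trans _ tK); rewrite ler_wpM2l ?ltW//.
    rewrite /K; have := normr_ge0 v; have := normr_ge0 w; lra.
  apply: le_lt_trans b2 (le_lt_trans _ tK); rewrite ler_wpM2l ?ltW//.
  rewrite /K; have := normr_ge0 v; have := normr_ge0 w; lra.
pose phi (r : R) := h (u + t *: w + r *: v) - h (u + r *: v).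
have dphi r : 0 <= r <= t ->
    is_derive r 1 phi (g (u + t *: w + r *: v) - g (u + r *: v)).
  move=> /lt1[/small[d1 _] /small[d2 _]].
  have dl a := is_derive_line a v r.
  apply: is_deriveB.
    have := @is_derive_comp_curve _ _ _ h
      (fun r => u + t *: w + r *: v) r _ ex_derive.
    rewrite derive_val; apply.
    by rewrite -addrA addrC (addrC (t *: w)).
  have := @is_derive_comp_curve _ _ _ h (fun r => u + r *: v) r _ ex_derive.
  by rewrite derive_val; apply; rewrite addrC.
have [xi xit phit] : exists2 c, c \in `]0, t[ &
    phi t - phi 0 = (g (u + t *: w + c *: v) - g (u + c *: v)) * (t - 0).
  apply: (MVT t0) => [r|].
    by rewrite in_itv/= => /andP[? ?]; apply: dphi; rewrite !ltW.
  apply: derivable_within_continuous => r; rewrite in_itv /= => rt.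
  by have [] := dphi r rt.
have xi_t : 0 <= xi <= t.
  by move: xit; rewrite in_itv/= => /andP[? ?]; rewrite !ltW.
have -> : h (u + t *: v + t *: w) - h (u + t *: v) - h (u + t *: w) + h u =
    phi t - phi 0.
  rewrite /phi scale0r !addr0 (addrAC u (t *: w)); ring.
have [b1 b2] := bnd _ xi_t; have [l1 l2] := lt1 _ xi_t.
have [_ s1] := small _ l1; have [_ s2] := small _ l2.
rewrite phit subr0; set D := g (u + t *: w + xi *: v) - g (u + xi *: v).
(* Subtracting the two first-order expansions of [g] at [u] cancels [L (xi *: v)]; the remainders
   add up to at most [e / K * (t * K)]. *)
have Dt : `|t * L w - D| <= t * e.
  have -> : t * L w - D = (g (xi *: v + u) - g u - L (xi *: v))
      - (g (xi *: v + t *: w + u) - g u - L (xi *: v + t *: w)).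
    have -> : L (xi *: v + t *: w) = L (xi *: v) + t * L w.
      by rewrite linearD /= [L (t *: w)]linearZ.
    have -> : xi *: v + t *: w + u = u + t *: w + xi *: v.
      by rewrite [LHS]addrC addrA addrAC.
    rewrite /D (addrC (xi *: v) u).
    have rearrange (a b c l m : R) :
      m - (a - b) = (b - c - l) - (a - c - (l + m)) by ring.
    exact: rearrange.
  rewrite (le_trans (ler_normB _ _))//.
  apply: le_trans (lerD s1 s2) _; rewrite -mulrDr.
  apply: le_trans (_ : e / K * (t * K) <= _); last first.
    by rewrite mulrCA divfK ?gt_eqF.
  rewrite ler_wpM2l ?(ltW e'0)//; apply: le_trans (lerD b1 b2) _.
  rewrite -mulrDr ler_wpM2l ?(ltW t0)// /K; lra.
have -> : L w - t ^- 2 * (D * t) = t^-1 * (t * L w - D).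
  by field; rewrite gt_eqF.
by rewrite normrM normfV (gtr0_norm t0) ler_pdivrMl.
Unshelve. all: by end_near. Qed.

Theorem derive_swap h u v w :
  (\forall y \near u, differentiable h y) ->
  (forall z, differentiable (fun y => 'D_z h y) u) ->
  'D_w (fun y => 'D_v h y) u = 'D_v (fun y => 'D_w h y) u.
Proof.
move=> dh dg; have vw := @cvg_second_difference h u v w dh (dg v).
have wv := @cvg_second_difference h u w v dh (dg w).
apply: cvg_unique vw _ => //; apply: cvg_trans wv; apply: near_eq_cvg.
by near=> t; rewrite (addrAC u (t *: w)); congr (_ * _); ring.
Unshelve. all: by end_near. Qed.

End SchwarzSymmetry.

(** Mean value theorem on [0, 1]; it serves for the squared norm of a parallel field. *)
Lemma derive0_endpoints {R : realType} (N : R -> R) :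
  (forall r : R, r \in `[0, 1]%R -> is_derive r 1 N 0) -> N 0 = N 1.
Proof.
move=> dN.
have dN' (r : R) : r \in `]0, 1[%R -> is_derive r 1 N ((fun=> 0) r).
  by rewrite in_itv/= => /andP[? ?]; apply: dN; rewrite in_itv/= !ltW.
have cN : {within `[0, 1], continuous N}.
  apply: derivable_within_continuous => r r01.
  by have [] := dN r r01.
have [xi _ /eqP] := MVT_segment ler01 dN' cN.
by rewrite mul0r subr_eq0 => /eqP.
Qed.

(** * Norms, metric and Levi-Civita connection in charts *)

Section Riemannian.
Context {R : realType} {n : nat} (X : riemannianManifold R n).
Implicit Types (x : X) (i : chart_index X) (s u v w : 'rV[R]_n) (f : X -> R).

(** Identities known at chart points thereby hold on a neighbourhood, so they may be
    differentiated. *)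
Lemma near_chart i x : chart_dom i x ->
  \forall y \near chart i x, exists2 z, chart_dom i z & y = chart i z.
Proof.
move=> ix; have : nbhs (chart i x) (chart i @` chart_dom i).
  by apply: open_nbhs_nbhs; split; [exact: chart_cod_open | exists x].
by apply: filterS => y [z iz <-]; exists z.
Qed.

Lemma metric_unitmx i x : chart_dom i x -> metric i (chart i x) \in unitmx.
Proof. by move=> ix; apply: bilin_pos_unitmx; exact: metric_pos. Qed.

Lemma metric_differentiable i x : chart_dom i x ->
  differentiable (metric i) (chart i x).
Proof.
by move=> ix; have [+ _] := @metric_smooth _ _ X i 1; apply; exists x.
Qed.

Lemma gram_sym x : (gram x)^T = gram x.
Proof. exact: (Defs.metric_sym (chart_at_dom x)). Qed.

Lemma gram_pos x v : v != 0 -> 0 < bilin (gram x) v v.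
Proof. exact: (metric_pos (chart_at_dom x)). Qed.

Lemma gram_unitmx x : gram x \in unitmx.
Proof. exact: (metric_unitmx (chart_at_dom x)). Qed.

Lemma rnorm_triangle x v w : rnorm x (v + w) <= rnorm x v + rnorm x w.
Proof. by apply: bilin_norm_triangle; [exact: gram_sym | exact: gram_pos]. Qed.

Lemma rnormZ x (a : R) v : rnorm x (a *: v) = `|a| * rnorm x v.
Proof.
rewrite /rnorm /inner bilinZl bilinZr mulrA -expr2 sqrtrM ?sqr_ge0//.
by rewrite sqrtr_sqr.
Qed.

Lemma rnorm0 x : rnorm x 0 = 0.
Proof. by rewrite /rnorm /inner bilin0l sqrtr0. Qed.

Lemma derive_partial (h : 'rV[R]_n -> R) u s : differentiable h u ->
  'D_s h u = \sum_l s 0 l * partial l h u.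
Proof.
move=> dh; rewrite deriveE// [in LHS](row_sum_delta s) linear_sum.
by apply: eq_bigr => l _; rewrite linearZ /partial deriveE.
Qed.

(** The connection form of chart [i] evaluated on [s], acting on row vectors from the right; it
    turns sums of Christoffel symbols into matrix products. *)
Definition connection_mx i u s : 'M[R]_n :=
  \matrix_(a, k) \sum_l christoffel_symbol i u l a k * s 0 l.

Lemma christoffelE i u s v : christoffel i u s v = v *m connection_mx i u s.
Proof.
apply/rowP => k; rewrite !mxE exchange_big /=; apply: eq_bigr => a _.
by rewrite mxE mulr_sumr; apply: eq_bigr => l _; rewrite mulrC.
Qed.

Lemma christoffelC i x v w : chart_dom i x ->
  christoffel i (chart i x) v w = christoffel i (chart i x) w v.
Proof.
move=> ix; apply/rowP => k; rewrite !mxE exchange_big /=.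
apply: eq_bigr => a _; apply: eq_bigr => b _.
by rewrite (christoffel_symbolC b a)// mulrAC.
Qed.

(** [christoffel_symbol_compat] gives this entrywise for the coordinate directions; linearity of the
    derivative in [s] gives the rest. *)
Lemma derive_metric i x s : chart_dom i x ->
  let u := chart i x in
  'D_s (metric i) u = connection_mx i u s *m metric i u
    + metric i u *m (connection_mx i u s)^T.
Proof.
move=> ix u; have dm := metric_differentiable ix.
rewrite derive_mx; last exact: diff_derivable.
apply/matrixP => a b; rewrite !mxE derive_partial; last first.
  exact: (differentiable_comp dm (differentiable_coord _ _ _)).
under eq_bigr do rewrite christoffel_symbol_compat// -/u.
rewrite -big_split /=.
under eq_bigr do rewrite mulr_sumr.
rewrite exchange_big /=; apply: eq_bigr => k _.
rewrite !mxE mulr_suml mulr_sumr -big_split /=; apply: eq_bigr => l _.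
ring.
Qed.

Lemma metric_compat i x s v w : chart_dom i x ->
  let u := chart i x in
  bilin ('D_s (metric i) u) v w =
  bilin (metric i u) (christoffel i u s v) w
  + bilin (metric i u) v (christoffel i u s w).
Proof.
move=> ix u; rewrite derive_metric// !christoffelE /bilin.
by rewrite mulmxDr mulmxDl mxE trmx_mul !mulmxA.
Qed.

(** * Gradient and Hessian in charts, and parallel transport *)

Lemma bilin_chart_grad f i x w : twice_differentiable f -> chart_dom i x ->
  bilin (metric i (chart i x)) (chart_grad f i (chart i x)) w =
  'D_w (f \o chart_inv i) (chart i x).
Proof.
move=> f2 ix; have [df _] := f2 _ _ ix.
by rewrite (deriveE _ df) -(gradientP _ (metric_unitmx ix) df).
Qed.

Lemma derivable_chart_grad f i x s : twice_differentiable f ->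
  chart_dom i x -> derivable (chart_grad f i) (chart i x) s.
Proof.
move=> f2 ix; have [df d2f] := f2 _ _ ix.
have dinv : derivable (fun y => invmx (metric i y)) (chart i x) s.
  apply: derivable_invmx; first exact/diff_derivable/metric_differentiable.
  by apply: filterS (near_chart ix) => _ [z iz ->]; exact: metric_unitmx.
apply/derivable_mxP => k j; rewrite (ord1 k).
under eq_fun => y do (rewrite /chart_grad /gradient mxE;
  under eq_bigr do rewrite mxE).
apply: ex_derive; apply: is_derive_fsum => a; apply/derivableP.
apply: (@derivableM _ _ (partial a (f \o chart_inv i))
  (fun y => invmx (metric i y) a j)).
  exact: (diff_derivable (d2f (delta_mx 0 a))).
by move/derivable_mxP : dinv; exact.
Qed.

(* Differentiate bilin G (grad f) w = D_w f in the direction s; by metric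
   compatibility one of the two connection terms completes D_s (grad f) to the
   Hessian. *)
Lemma inner_hess f x s w : twice_differentiable f ->
  let i := chart_at x in let u := chart i x in
  inner x (hess f x s) w =
  'D_s (fun y => 'D_w (f \o chart_inv i) y) u
  - inner x (grad f x) (christoffel i u s w).
Proof.
move=> f2 i u; have ix : chart_dom i x := chart_at_dom x.
rewrite /inner /hess -/i -/u bilinDl /gram -/i -/u.
have -> : 'D_s (fun y => 'D_w (f \o chart_inv i) y) u =
    'D_s (fun y => bilin (metric i y) (chart_grad f i y) w) u.
  apply: near_eq_derive; apply: filterS (near_chart ix) => _ [z iz ->].
  by rewrite bilin_chart_grad.
have /@derive_val -> := is_derive_bilin
  (diff_derivable (metric_differentiable ix))
  (derivable_chart_grad f2 ix) (derivable_cst w u s).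
rewrite derive_cst /= (bilinC _ 0 (Defs.metric_sym ix)) bilin0l addr0.
rewrite metric_compat// /grad /chart_grad -/u /=; ring.
Qed.

(** Both terms of [inner_hess] are symmetric in [s] and [w]: the second derivative by Schwarz's
    theorem, the Christoffel term by torsion-freeness. *)
Lemma inner_hessC f x s w : twice_differentiable f ->
  inner x (hess f x s) w = inner x s (hess f x w).
Proof.
move=> f2; have ix := chart_at_dom x.
have -> : inner x s (hess f x w) = inner x (hess f x w) s.
  exact: bilinC (gram_sym x).
rewrite (inner_hess x s w f2) (inner_hess x w s f2) (christoffelC s w ix).
rewrite (@derive_swap _ _ _ _ w s)//.
  by apply: filterS (near_chart ix) => _ [z iz ->]; have [] := f2 _ _ iz.
by have [_] := f2 _ _ ix.
Qed.

(** Directional derivability of [chart_grad] alone does not give linearity in the direction.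
    Self-adjointness does: tested against [w], the direction moves into a slot where the inner
    product is linear. *)
Lemma hessP f x (a : R) s v : twice_differentiable f ->
  hess f x (a *: v + s) = a *: hess f x v + hess f x s.
Proof.
move=> f2; apply: (eq_bilinr (gram_unitmx x)) => w.
rewrite -/(inner x _ _) inner_hessC//.
have vw := inner_hessC x v w f2; have sw := inner_hessC x s w f2.
rewrite /inner in vw sw *.
by rewrite (bilinDl _ (a *: v)) (bilinDl _ (a *: hess f x v)) !bilinZl vw sw.
Qed.

(** By metric compatibility the derivative of the metric along [c] contributes two Christoffel
    terms, which the parallel transport equation for [W] cancels. *)
Lemma parallel_inner_derive (c : R -> X) (V : R -> 'rV[R]_n) (t : R) :
  geodesic_at c t -> parallel_at c V t ->
  is_derive t 1 (fun r => inner (c r) (V r) (V r)) 0.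
Proof.
move=> [cc geo] par; pose i := chart_at (c t).
have it : chart_dom i (c t) := chart_at_dom (c t).
have [/nbhs_singleton dy _ _] := geo i it.
have [dW DW] := par i it.
set W := fun r => tangent_coord i (c r) (V r) in dW DW.
have near_i : \forall r \near t, chart_dom i (c r).
  apply: cc; apply: open_nbhs_nbhs; split; last exact: it.
  exact: chart_dom_open.
pose A := metric i \o (chart i \o c).
(* [V r] is given in the chart [chart_at (c r)], which changes with [r]; the tensor law of the
   metric moves everything to the fixed chart [i] near [t]. *)
apply: (@near_eq_is_derive _ _ _ (fun r => bilin (A r) (W r) (W r))).
  apply: filterS near_i => r ir; rewrite /A /W /=.
  by rewrite metric_transition//; exact: chart_at_dom.
have dA := is_derive_comp_curve (metric_differentiable it) dy.
apply: is_derive_eq.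
  by apply: is_derive_bilin => //; exact: ex_derive.
rewrite (@derive_val _ _ _ _ _ _ _ dA) metric_compat//.
rewrite DW -scaleN1r bilinZl bilinZr; rewrite /A /=; ring.
Qed.

Lemma parallel_transport_rnorm x s g w : exp_dom x s ->
  parallel_transport (exp_curve x s) g w -> rnorm x g = rnorm (rexp x s) w.
Proof.
(* As [s] lies in [exp_dom x], [exp_curve x s] is a geodesic and not the mere default value of
   [xget]. *)
move=> xs; have [c0 _ [e e0 geo]] : geodesic_from x s (exp_curve x s).
  by apply: xgetPex; exact: xs.
move=> [V [<- <- [e' e'0 par]]].
pose N r := inner (exp_curve x s r) (V r) (V r).
have dN (r : R) : r \in `[0, 1]%R -> is_derive r 1 N 0.
  rewrite in_itv /= => /andP[r0 r1].
  have r_in (d : R) : 0 < d -> - d < r < 1 + d.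
    move=> d0; rewrite (lt_le_trans _ r0) ?oppr_lt0//=.
    by rewrite (le_lt_trans r1) ?ltrDl.
  by apply: parallel_inner_derive; [apply: geo | apply: par]; exact: r_in.
have := derive0_endpoints dN; rewrite /N c0 => N01.
by rewrite /rnorm N01.
Qed.

End Riemannian.

(** * The gradient of the cubic model *)

Section ModelGradient.
Context {R : realType} {n : nat} (X : riemannianManifold R n).
Implicit Types (x : X) (s e : 'rV[R]_n) (f : X -> R) (M : R).

Lemma is_derive_inner x (v w : 'rV[R]_n -> 'rV[R]_n) s e dv dw :
  is_derive s e v dv -> is_derive s e w dw ->
  is_derive s e (fun y => inner x (v y) (w y))
    (inner x dv (w s) + inner x (v s) dw).
Proof.
move=> [hv <-] [hw <-]; apply: is_derive_eq.
  exact: (is_derive_bilin (derivable_cst (gram x) s e) hv hw).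
by rewrite derive_cst /inner [X in X + _ + _](_ : _ = 0) ?add0r//
  /bilin mulmx0 mul0mx mxE.
Qed.

Lemma rnorm_gt0 x s : s != 0 -> 0 < rnorm x s.
Proof. by move=> s0; rewrite sqrtr_gt0; exact: gram_pos. Qed.

(** For [s != 0] this is the chain rule through the square root, whose argument is then positive at
    0. At [s = 0], where the square root is not differentiable, Carathéodory's criterion is used. *)
Lemma is_derive_rnorm3 x s e :
  is_derive s e (fun y => rnorm x y ^+ 3) (3 * rnorm x s * inner x s e).
Proof.
apply/is_derive_along; have [->|s0] := eqVneq s 0.
  rewrite rnorm0 mulr0 mul0r; apply/is_derive1_caratheodory.
  (* The slope comes from [|z|^3 = (z * |z|) * z]; it is continuous and vanishes at 0. *)
  exists (fun z => z * `|z| * rnorm x e ^+ 3); split.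
  - move=> z; rewrite !addr0 scale0r rnorm0 expr0n subr0 rnormZ exprMn.
    by rewrite exprS real_normK ?num_real//; ring.
  - apply: cvgM; last exact: cvg_cst.
    apply: cvgM; first exact: cvg_id.
    exact: norm_continuous.
  - by rewrite !mul0r.
pose q (h : R) := inner x (h *: e + s) (h *: e + s).
have q0 : q 0 = rnorm x s ^+ 2.
  rewrite /q scale0r add0r sqr_sqrtr//.
  by rewrite ltW//; exact: gram_pos.
have dq : is_derive (0 : R) 1 q (2 * inner x s e).
  apply/(@is_derive_along _ _ _ (fun y => inner x y y)); apply: is_derive_eq.
    exact: (is_derive_inner x (is_derive_id s e) (is_derive_id s e)).
  by rewrite /inner (bilinC _ e (gram_sym x)); ring.
have r0 := rnorm_gt0 x s0.
have q0_gt0 : 0 < q 0 by rewrite q0 exprn_gt0.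
have dsq := is_derive1_comp (is_derive1_sqrt q0_gt0) dq.
rewrite (_ : (fun h => _) = (Num.sqrt \o q) ^+ 3); last first.
  by apply/funext => h; rewrite exprfctE.
apply: (is_derive_eq (is_deriveX 3 dsq)).
rewrite /= q0 sqrtr_sqr gtr0_norm// /GRing.scale /=.
by field; rewrite gt_eqF.
Qed.

(** The product rule yields two halves of the Hessian term, one with [hess f x s] and one with
    [hess f x e]; self-adjointness merges them. *)
Lemma is_derive_cubic_model f M x s e : twice_differentiable f ->
  is_derive s e (cubic_model f M x)
    (inner x (grad f x + hess f x s + (M * rnorm x s) *: s) e).
Proof.
move=> f2.
have d1 := is_derive_inner x (is_derive_id s e) (is_derive_cst (grad f x) s e).
have dh : is_derive s e (hess f x) (hess f x e).
  by apply: is_derive_linear => a y z; exact: hessP.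
have d2 := is_derive_inner x (is_derive_id s e) dh.
have d3 := is_derive_rnorm3 x s e.
have D := is_deriveD (is_deriveD (is_deriveD (is_derive_cst (f x) s e) d1)
  (is_deriveZ 2^-1 d2)) (is_deriveZ (M / 3) d3).
apply: (is_derive_eq D).
move: (hess f x s) (hess f x e) (grad f x) (inner_hessC x s e f2) => hs he g.
rewrite /inner => sym; rewrite !bilinDl !bilinZl -sym.
rewrite (bilinC s 0 (gram_sym x)) bilin0l (bilinC e g (gram_sym x)).
by rewrite (bilinC e hs (gram_sym x)) /GRing.scale /=; field.
Qed.

Lemma model_gradE f M x s : twice_differentiable f ->
  model_grad f M x s = grad f x + hess f x s + (M * rnorm x s) *: s.
Proof.
move=> f2; rewrite /model_grad /gradient.
apply: (can_inj (mulmxK (gram_unitmx x))); rewrite mulmxKV ?gram_unitmx//.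
apply/rowP => a; rewrite mxE /partial.
have /@derive_val -> := is_derive_cubic_model M x s (delta_mx 0 a) f2.
by rewrite /inner /bilin trmx_delta -colE mxE.
Qed.

End ModelGradient.

(** * One-step estimates and the descent inequality *)

Section Descent.
Context {R : realType} {n : nat} (X : riemannianManifold R n).
Context (rho theta M : R) (f : X -> R).
Context (f2 : twice_differentiable f) (flip : lipschitz_hessian rho f).

(** Above the second-order Taylor polynomial, [f (rexp x s)] lies by at most [rho / 6 * r^3] and the
    model by exactly [M / 3 * r^3], where [r = rnorm x s]; the model at 0 is [f x]. *)
Lemma cubic_descent (x : X) s : exp_dom x s ->
  cubic_model f M x s <= cubic_model f M x 0 ->
  f (rexp x s) <= f x - (M / 3 - rho / 6) * rnorm x s ^+ 3.
Proof.
move=> xs; rewrite [X in _ <= X -> _]/cubic_model rnorm0 /inner !bilin0l.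
rewrite -/(inner x _ _) expr0n /= !mulr0 !addr0 /cubic_model => mle.
have := flip.1 _ _ xs; rewrite ler_norml => /andP[_]; lra.
Qed.

Lemma rnorm_grad_rexp (x : X) s : 0 <= M -> exp_dom x s ->
  rnorm x (model_grad f M x s) <= theta * rnorm x s ^+ 2 ->
  rnorm (rexp x s) (grad f (rexp x s)) <=
    (rho / 2 + theta + M) * rnorm x s ^+ 2.
Proof.
move=> M0 xs; rewrite model_gradE// => mle.
have [g /(parallel_transport_rnorm xs) <- gle] := flip.2 _ _ xs.
(* The gradient [g] transported back to [x] is the Taylor error [d] plus the model gradient [p]
   minus [M r s], with [r = rnorm x s]; their norms are at most [rho / 2], [theta] and [M] times
   [r^2]. *)
set p := _ + _ + _ in mle; pose d := g - grad f x - hess f x s.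
have {1}-> : g = d + (p + (- (M * rnorm x s)) *: s).
  by rewrite scaleNr addrK /d -(addrA g) -opprD subrK.
have dp := rnorm_triangle x d (p + (- (M * rnorm x s)) *: s).
have ps := rnorm_triangle x p ((- (M * rnorm x s)) *: s).
have := rnormZ x (- (M * rnorm x s)) s.
rewrite normrN ger0_norm ?mulr_ge0 ?sqrtr_ge0// => Ms.
rewrite -/d in gle; lra.
Qed.

End Descent.

Theorem mainTheorem4 (R : realType) (n : nat) (X : riemannianManifold R n)
    (rho theta : R) (rho_ge0 : 0 <= rho) (theta_ge0 : 0 <= theta)
    (f : X -> R) (f_diff2 : twice_differentiable f)
    (f_lip : lipschitz_hessian rho f) (M : R) (rho_M : rho / 2 < M) :
  exists c : R, 0 < c /\
    forall (x : nat -> X) (s : nat -> 'rV[R]_n),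
      cubic_newton_run f M theta x s ->
      forall k : nat,
        f (x k.+1) <= f (x k)
          - c * rnorm (x k.+1) (grad f (x k.+1)) `^ (3 / 2).
Proof.
have M_gt0 : 0 < M by rewrite (le_lt_trans _ rho_M)// divr_ge0.
pose C := rho / 2 + theta + M.
have C_gt0 : 0 < C by rewrite /C ltr_wpDl// addr_ge0// divr_ge0.
have CP : 0 < C `^ (3 / 2) by exact: powR_gt0.
have D_gt0 : 0 < M / 3 - rho / 6 by lra.
exists ((M / 3 - rho / 6) / C `^ (3 / 2)); split; first exact: divr_gt0.
move=> x s run k; have [xs -> mle gle] := run k.
have step := cubic_descent f_lip xs mle.
have gnext := rnorm_grad_rexp f_diff2 f_lip (ltW M_gt0) xs gle.
apply: le_trans step _; rewrite lerD2l lerN2.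
set r := rnorm (x k) (s k) in gnext *.
have r_ge0 : 0 <= r by exact: sqrtr_ge0.
rewrite -mulrA ler_wpM2l ?(ltW D_gt0)// ler_pdivrMl//.
(* In this form the right-hand side becomes [(C * r^2)] to the power 3/2, and [gnext] is raised to
   that power by monotonicity. *)
have -> : r ^+ 3 = (r ^+ 2) `^ (3 / 2).
  rewrite -(powR_mulrn 3 r_ge0) -(powR_mulrn 2 r_ge0) -powRrM; congr (_ `^ _).
  by rewrite mulrCA divff// mulr1.
rewrite -powRM ?(ltW C_gt0) ?sqr_ge0//.
apply: ge0_ler_powR => //; rewrite ?nnegrE ?sqrtr_ge0//.
by rewrite mulr_ge0 ?(ltW C_gt0) ?sqr_ge0.
Qed.
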